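(* Let $\tau=\{\tau_1,\dots,\tau_n\}$ be an implicit-deadline sporadic task system on a heterogeneous platform of $m\ge 1$ processors with $z$ distinct speeds $1=\alpha_1<\alpha_2<\dots<\alpha_z=\alpha_{max}$, with $u_i\le\alpha_{max}$ for every task and $|\Phi_i|\le|\Psi_i|$ for each $1\le i<z$. Let $$x=\max\left(0,\ \frac{\overline{E}-p_{min}}{R_{sum}-\overline{U}_{m-1}}\right).$$ If $U_{sum}\le R_{sum}$, then the response time of any task $\tau_i$ scheduled under (preemptive) GEDF-H is at most $x+2\cdot p_i$.
   Context: Platform: there are $z\ge1$ kinds of processors; $\chi_i$ is the set of processors of kind $i$, $M_i=|\chi_i|\ge 1$, each of speed $\alpha_i$, with $1=\alpha_1<\alpha_2<\dots<\alpha_z=\alpha_{max}$; $m=\sum_i M_i$ and $R_{sum}=\sum_{i=1}^z\alpha_i M_i$. A job running for $t$ time units on a processor of speed $\alpha$ completes $\alpha t$ units of workload. Time is continuous and all parameters are positive rationals. Tasks: each sporadic task $\tau_i$ releases a sequence of jobs $\tau_{i,1},\tau_{i,2},\dots$; $\tau_{i,j}$ is released at $r_{i,j}$, consecutive releases are at least $p_i$ apart, each job requires at most $e_i$ units of workload, and its absolute deadline is $d_{i,j}=r_{i,j}+p_i$ (implicit deadlines). $u_i=e_i/p_i$, $U_{sum}=\sum_i u_i$, $p_{min}=\min_i p_i$. Tasks are independent, jobs of the same task must execute in sequence (a job cannot start before its predecessor completes), a job executes on at most one processor at a time and a processor executes at most one job at a time. A deadline miss does not alter later release times. If $\tau_{i,j}$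 completes at time $t$, its response time is $\max(0,t-r_{i,j})$; a task's response time is the maximum (supremum) over its jobs. Notation: for $1\le i<z$, $\Phi_i=\{\tau_j:\alpha_i<u_j\}$; $\Psi_i=\bigcup_{j=i+1}^z\chi_j$. GEDF-H (preemptive): jobs are prioritized by earliest absolute deadline, ties broken by lower task index. A job is enabled at $t$ if it has been released by $t$, is not completed, and its predecessor (if any) has completed. At every instant the $m$ highest-priority enabled jobs (all of them if fewer than $m$) execute, with preemption and migration allowed, and processors are selected as follows when a job of $\tau_l$ is assigned: if $u_l\le1$, any available processor is used; if $\alpha_i<u_l\le\alpha_{i+1}$, an available processor of $\Psi_i$ is used if there is one; otherwise some job of a task with utilization at most $\alpha_i$ that is executing on a processor $M'\in\Psi_i$ is moved to an available processor and the job of $\tau_l$ is assigned to $M'$. The rule guarantees that whenever a job of $\tau_i$ executes on a processor of speed $\alpha'$, one has $u_i\le\alpha'$. $\overline{U}_{m-1}$ is the sum of the $m-1$ largest values $u_i$ among tasks of $\tau$ (of all of them if $n<m-1$). $\overline{E}$ is the largest value of $\sum_{\tau_i\in\psi,\ \alpha_j\in\varphi}\left(e_i+u_i\left(p_i-\frac{e_i}{\alpha_j}\right)\right)$, where $\psi$ ranges over sets of $m-1$ tasks of $\tau$ (all tasks if $n<m-1$), $\varphi$ is the collection of speeds of the $m-1$ fastest processors, and each task of $\psi$ is paired with a distinct processor among these $m-1$ (maximum taken over $\psi$ and over such pairings). *)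

(* Defs.v *)
From HB Require Import structures.
From mathcomp Require Import all_boot all_order all_algebra.
From mathcomp Require Import all_classical all_reals all_analysis.
Set Implicit Arguments. Unset Strict Implicit. Unset Printing Implicit Defensive.
Import Order.TTheory GRing.Theory Num.Theory.
Local Open Scope classical_set_scope.
Local Open Scope ring_scope.

(* Largest and smallest element of a nonempty list (0 on the empty list). *)
Definition maxl (s : seq rat) : rat := \big[Order.max/head 0 s]_(v <- s) v.
Definition minl (s : seq rat) : rat := \big[Order.min/head 0 s]_(v <- s) v.

(* All kinds, tasks and jobs are numbered from 0; there are z = nkinds.+1 kinds
   of processors, the slowest being ord0 and the fastest ord_max. *)
Record platform := Platform {
  nkinds : nat;
  alpha : 'I_nkinds.+1 -> rat;
  proc : finType;
  kind : proc -> 'I_nkinds.+1;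
  alpha_ord0 : alpha ord0 = 1;
  alpha_incr : forall k l : 'I_nkinds.+1, (k < l)%N -> alpha k < alpha l;
  kind_inhabited : forall k, exists q, kind q = k
}.

Record task_system (n : nat) := TaskSystem {
  wcet : 'I_n -> rat;
  period : 'I_n -> rat;
  wcet_gt0 : forall i, 0 < wcet i;
  period_gt0 : forall i, 0 < period i
}.

Section Platform_and_tasks.
Variables (P : platform) (n : nat) (tau : task_system n).

Definition chi (k : 'I_(nkinds P).+1) : {set proc P} :=
  [set q : proc P | kind q == k]%SET.
Definition nproc : nat := #|proc P|.
Definition speed (q : proc P) : rat := alpha (kind q).
Definition alpha_max : rat := alpha (@ord_max (nkinds P)).
Definition R_sum : rat := \sum_k alpha k * (#|chi k|)%:R.

Definition util (i : 'I_n) : rat := wcet tau i / period tau i.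
Definition U_sum : rat := \sum_i util i.
Definition p_min : rat := minl [seq period tau i | i <- enum 'I_n].

Definition Phi (k : 'I_(nkinds P).+1) : {set 'I_n} :=
  [set j : 'I_n | alpha k < util j]%SET.
Definition Psi (k : 'I_(nkinds P).+1) : {set proc P} :=
  (\bigcup_(l : 'I_(nkinds P).+1 | (k < l)%N) chi l)%SET.

Definition U_bar : rat :=
  \sum_(v <- take nproc.-1 (sort >=%O [seq util i | i <- enum 'I_n])) v.

Definition fastest : seq (proc P) :=
  take nproc.-1 (sort (fun q q' => speed q' <= speed q) (enum (proc P))).

(* [f] pairs the tasks of [psi] with distinct processors among the fastest;
   its values outside [psi] are irrelevant. *)
Definition pairing (psi : {set 'I_n}) (f : {ffun 'I_n -> proc P}) : bool :=
  [&& #|psi| == minn n nproc.-1,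
      [forall i in psi, f i \in fastest] &
      [forall i in psi, forall j in psi, (f i == f j) ==> (i == j)]].

Definition pairing_value (psi : {set 'I_n}) (f : {ffun 'I_n -> proc P}) : rat :=
  \sum_(i in psi)
    (wcet tau i + util i * (period tau i - wcet tau i / speed (f i))).

Definition E_bar : rat :=
  maxl [seq pairing_value w.1 w.2 |
         w <- enum (({set 'I_n} * {ffun 'I_n -> proc P})%type : finType)
         & pairing w.1 w.2].

Definition x_bound : rat :=
  Order.max 0 ((E_bar - p_min) / (R_sum - U_bar)).

End Platform_and_tasks.

Definition job (n : nat) : Type := ('I_n * nat)%type.

Definition assignment (P : platform) (n : nat) : Type :=
  {ffun proc P -> option ('I_n * nat)%type}.

Section Selection.
Variables (P : platform) (n : nat) (tau : task_system n).

Definition idle : assignment P n := [ffun=> None].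

Definition put (A : assignment P n) (q : proc P) (J : job n) : assignment P n :=
  [ffun q' => if q' == q then Some J else A q'].

(* [place A J B]: assigning [J] when [A] is in force results in [B].  A job
   [J'] displaced by [J] is moved by being assigned again under the same rule;
   moving it to an arbitrary available processor could leave it on one slower
   than its utilization.  The recursion ends, since [util J'.1 < util J.1]. *)
Inductive place (A : assignment P n) (J : job n) : assignment P n -> Prop :=
| place_any q :
    util tau J.1 <= 1 -> A q = None -> place A J (put A q J)
| place_available (k k' : 'I_(nkinds P).+1) q :
    k' = k.+1 :> nat -> alpha k < util tau J.1 <= alpha k' ->
    q \in Psi k -> A q = None -> place A J (put A q J)
| place_displace (k k' : 'I_(nkinds P).+1) q J' B :
    k' = k.+1 :> nat -> alpha k < util tau J.1 <= alpha k' ->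
    (forall q', q' \in Psi k -> A q' <> None) ->
    q \in Psi k -> A q = Some J' -> util tau J'.1 <= alpha k ->
    place (put A q J) J' B -> place A J B.

(* Migration being unrestricted, the assignment in force at an instant is built
   from the idle platform.  This covers policies that leave running jobs in
   place: whatever they reach can also be reached by placing each job directly
   on its processor. *)
Inductive assigned : seq (job n) -> assignment P n -> Prop :=
| assigned_nil : assigned [::] idle
| assigned_cons J s A B : assigned s A -> place A J B -> assigned (J :: s) B.

End Selection.

Section Scheduling.
Variables (R : realType) (P : platform) (n : nat) (tau : task_system n).
(* Release times and workloads of the jobs, and a schedule; time starts at 0. *)
Variables (r c : 'I_n -> nat -> R) (sched : R -> assignment P n).

Definition sporadic_releases : Prop :=
  forall i j, 0 <= r i j /\ r i j + ratr (period tau i) <= r i j.+1.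

Definition bounded_workloads : Prop :=
  forall i j, 0 <= c i j <= ratr (wcet tau i).

Definition deadline (J : job n) : R := r J.1 J.2 + ratr (period tau J.1).

Definition higher_priority (J J' : job n) : Prop :=
  deadline J < deadline J' \/ (deadline J = deadline J' /\ (J.1 < J'.1)%N).

Definition run_set (J : job n) (q : proc P) : set R :=
  [set s | 0 <= s /\ sched s q = Some J].

(* Without measurability the workload completed by a job is meaningless. *)
Definition measurable_schedule : Prop :=
  forall J q, measurable (run_set J q : set (measurableTypeR R)).

Definition work (J : job n) (t : R) : R :=
  \sum_(q : proc P)
    ratr (speed q) * fine (lebesgue_measure (run_set J q `&` [set s | s < t])).

(* Release and predecessors are mentioned only for the sake of jobs with
   workload 0, which complete as soon as they are released and their
   predecessor has completed; other jobs receive no work before that. *)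
Definition completed (J : job n) (t : R) : Prop :=
  forall k, (k <= J.2)%N -> r J.1 k <= t /\ c J.1 k <= work (J.1, k) t.

Definition enabled (t : R) (J : job n) : Prop :=
  [/\ r J.1 J.2 <= t, ~ completed J t &
      forall k, J.2 = k.+1 -> completed (J.1, k) t].

Definition selected (t : R) (J : job n) : Prop :=
  enabled t J /\
  ([set J' | enabled t J' /\ higher_priority J' J] #<= `I_(nproc P).-1)%card.

Definition gedfh_schedule : Prop :=
  measurable_schedule /\
  forall t, 0 <= t -> exists s : seq ('I_n * nat)%type,
    [/\ uniq s, forall J, J \in s <-> selected t J & assigned tau s (sched t)].

(* +oo if the job never completes *)
Definition completion_time (J : job n) : \bar R :=
  ereal_inf [set t%:E | t in [set t : R | 0 <= t /\ completed J t]].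

Definition job_response_time (J : job n) : \bar R :=
  maxe 0%E (completion_time J - (r J.1 J.2)%:E)%E.

Definition response_time (i : 'I_n) : \bar R :=
  ereal_sup [set job_response_time (i, j) | j in [set: nat]].

End Scheduling.

(* Main.v *)
(* The proof is by induction on deadlines, but of more than the response-time
   bound: writing [v = max 1 u], a job with deadline [d] has at most [v * (p - s)]
   of its workload left at time [d + x + s], for every [0 <= s <= p]. Fix a
   deadline [D] and call a job urgent if its deadline is at most [D]. At an
   instant with fewer than [m] enabled urgent jobs, a task with such a job lags
   by at most [u * x + e + u * (p - e / v)]; summed over at most [m - 1] tasks
   this is at most [U_bar * x + E_bar <= R_sum * x + p_min], where [E_bar] enters
   through a pairing that only exists because of [#|Phi| <= #|Psi|]: the tasks in
   order of decreasing utilization with the processors in order of decreasing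
   speed. As the platform is saturated with urgent work at all other instants,
   at most [R_sum * x + p_min] of urgent work is left at [D]. After [D], either
   fewer than [m] urgent jobs remain enabled from some instant before [D + x] on,
   and the job with deadline [D] then executes without interruption at speed at
   least [v], or at most [p_min] of urgent work is left at [D + x], which shrinks
   at rate at least [v] as long as that job is not completed. *)
Require Import Defs.
From mathcomp Require Import all_boot all_order all_algebra.
From mathcomp Require Import all_classical all_reals all_analysis.
From mathcomp Require Import measurable_realfun.
From mathcomp Require Import lra zify ring.
Set Implicit Arguments. Unset Strict Implicit. Unset Printing Implicit Defensive.
Import Order.TTheory GRing.Theory Num.Theory.
Local Open Scope ring_scope.

(** * Finite sets, and sums of the largest values of a function *)

Lemma exists_superset (T : finType) (A : {set T}) k :
  (#|A| <= k <= #|T|)%N -> exists2 B : {set T}, A \subset B & #|B| = k.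
Proof.
move=> /andP[leAk lekT].
have sz : (k - #|A| <= size (enum (~: A)%SET))%N.
  by rewrite -cardE; have := cardsC A; lia.
pose s := take (k - #|A|) (enum (~: A)%SET).
exists (A :|: [set x in s])%SET; first exact: finset.subsetUl.
rewrite cardsU (_ : (A :&: _)%SET = finset.set0); last first.
  apply/finset.setP => x; rewrite !inE; apply/andP => -[xA /mem_take].
  by rewrite mem_enum inE xA.
rewrite cards0 subn0 cardsE (card_uniqP _) ?take_uniq ?enum_uniq //.
by rewrite size_takel // subnKC.
Qed.

(** For every threshold [th >= 0], each [f i] is at most [th + max 0 (f i - th)], so the sum over
    [S] is at most [k * th] plus all the overshoots. With [th] the value at position [k] of the
    sorted list, the first [k] values attain this bound. *)
Lemma sum_le_take_sort (T : finType) (f : T -> rat) (S : {set T}) k :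
  (forall i, 0 <= f i) -> (#|S| <= k)%N ->
  \sum_(i in S) f i <= \sum_(v <- take k (sort >=%O [seq f i | i <- enum T])) v.
Proof.
move=> f0 leSk; rewrite sort_map -map_take big_map.
set L := sort _ _.
have Lmem x : x \in L by rewrite mem_sort mem_enum.
have Luniq : uniq L by rewrite sort_uniq enum_uniq.
have Lsort : sorted (relpre f >=%O) L.
  by apply: sort_sorted => x y; exact: ge_total.
have ftr : transitive (relpre f >=%O) by move=> y x z /= xy yz; exact: le_trans yz xy.
have frefl : reflexive (relpre f >=%O) by move=> y /=.
(* the first value that is left out serves as a threshold *)
pose th := nth 0 (map f L) k.
have th0 : 0 <= th.
  rewrite /th; case: (ltnP k (size (map f L))) => kL; last by rewrite nth_default.
  by have /mapP[x _ ->] := mem_nth 0 kL.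
have hi x : x \in take k L -> th <= f x.
  move=> xk; rewrite /th; case: (ltnP k (size L)) => kL; last first.
    by rewrite nth_default ?size_map.
  rewrite (nth_map x) //.
  have ix : (index x (take k L) < k)%N.
    by have := xk; rewrite -index_mem size_takel // ltnW.
  have xE : x = nth x L (index x (take k L)) by rewrite -(nth_take x ix) nth_index.
  rewrite [in leRHS]xE.
  by apply: (sorted_leq_nth ftr frefl x Lsort (index x (take k L)) k);
    rewrite ?inE ?(ltn_trans ix) // ltnW.
have lo x : x \notin take k L -> f x <= th.
  move=> xk; have kx : (k <= index x L)%N.
    rewrite leqNgt; apply/negP => /= lt; move/negP: xk; apply.
    rewrite -(nth_index x (Lmem x)) -(nth_take x lt) mem_nth //.
    rewrite size_take_min leq_min lt /=.
    by rewrite index_mem.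
  have ixL : (index x L < size L)%N by rewrite index_mem.
  rewrite /th (nth_map x) ?(leq_ltn_trans kx) // -[in leLHS](nth_index x (Lmem x)).
  by apply: (sorted_leq_nth ftr frefl x Lsort k (index x L));
    rewrite ?inE // (leq_ltn_trans kx).
(* If fewer than [k] values exist, [th] is the default value 0 and both sides vanish. *)
have kth : k%:R * th = (size (take k L))%:R * th.
  rewrite size_take_min; case: (leqP k (size L)) => [//|lt].
  by rewrite /th nth_default ?mulr0 // size_map ltnW.
apply: (@le_trans _ _ (\sum_(i in S) (th + Num.max 0 (f i - th)))).
  apply: ler_sum => i _; rewrite -lerBlDl le_max lexx orbT //.
rewrite big_split /= sumr_const.
apply: (@le_trans _ _ (k%:R * th + \sum_i Num.max 0 (f i - th))).
  apply: lerD; first by rewrite -[leLHS]mulr_natl ler_wpM2r // ler_nat.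
  by rewrite [leRHS](bigID (mem S)) /= lerDl sumr_ge0 // => i _; rewrite le_max lexx.
rewrite kth (bigID (mem (take k L))) /= [X in _ + (_ + X)]big1 ?addr0; last first.
  by move=> i /lo; rewrite -subr_le0 => /max_idPl.
rewrite -big_uniq ?take_uniq //=.
rewrite (eq_big_seq (fun i => f i - th)); last first.
  by move=> i /hi; rewrite -subr_ge0 => /max_idPr.
rewrite big_split /= big_const_seq count_predT iter_addr addr0 mulNrn.
by rewrite -[th *+ _]mulr_natl addrC addNKr.
Qed.

(** * Processor speeds and the capacity of the platform *)

Section Platform.
Variable P : platform.

Lemma le_alpha (k l : 'I_(nkinds P).+1) : (k <= l)%N -> alpha k <= alpha l.
Proof.
rewrite leq_eqVlt => /orP[/eqP/val_inj->//|kl]; exact/ltW/alpha_incr.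
Qed.

Lemma lt_alpha (k l : 'I_(nkinds P).+1) : alpha k < alpha l -> (k < l)%N.
Proof. by move=> kl; rewrite ltnNge; apply/negP => /le_alpha; rewrite leNgt kl. Qed.

Lemma speed_ge1 (q : proc P) : 1 <= speed q.
Proof. by rewrite -(alpha_ord0 P) le_alpha. Qed.

Lemma speed_gt0 (q : proc P) : 0 < speed q.
Proof. exact: lt_le_trans ltr01 (speed_ge1 q). Qed.

Lemma R_sumE : R_sum P = \sum_(q : proc P) speed q.
Proof.
rewrite /R_sum (partition_big (@kind P) xpredT) //=.
apply: eq_bigr => k _; rewrite (eq_bigr (fun=> alpha k)) => [|q /eqP kq].
  by rewrite sumr_const -[RHS]mulr_natr; congr (_ * _%:R); apply: eq_card => q; rewrite !inE.
by rewrite /speed kq.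
Qed.

Lemma speed_le_R_sum (q : proc P) : speed q <= R_sum P.
Proof.
rewrite R_sumE (bigD1 q) //= lerDl sumr_ge0 // => q' _; exact/ltW/speed_gt0.
Qed.

Lemma R_sum_ge1 : 1 <= R_sum P.
Proof.
have [q _] := kind_inhabited (@ord0 (nkinds P)).
exact: le_trans (speed_ge1 q) (speed_le_R_sum q).
Qed.

Lemma alpha_max_le_R_sum : alpha_max P <= R_sum P.
Proof.
have [q qmax] := kind_inhabited (@ord_max (nkinds P)).
by rewrite /alpha_max -qmax speed_le_R_sum.
Qed.

Lemma in_Psi (k : 'I_(nkinds P).+1) q : (q \in Psi k) = (alpha k < speed q).
Proof.
apply/bigcupP/idP => [[l kl]|kq].
  by rewrite inE => /eqP ql; rewrite /speed ql alpha_incr.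
by exists (kind q); rewrite ?inE // lt_alpha.
Qed.

Lemma nproc_gt0 : (0 < nproc P)%N.
Proof. by have [q _] := kind_inhabited (@ord0 (nkinds P)); apply/card_gt0P; exists q. Qed.

Lemma size_fastest : size (fastest P) = (nproc P).-1.
Proof. by rewrite size_takel // size_sort -cardE leq_pred. Qed.

End Platform.

Lemma minl_le (s : seq rat) v : v \in s -> minl s <= v.
Proof.
by move=> vs; rewrite /minl (@ge_bigmin_seq _ _ _ _ _ v xpredT id).
Qed.

Lemma le_maxl (s : seq rat) v : v \in s -> v <= maxl s.
Proof. by move=> vs; rewrite /maxl (@le_bigmax_seq _ _ _ _ _ v xpredT id). Qed.

(** * Utilizations, pairings, and the inequality that determines [x_bound] *)

Section Tasks.
Variables (P : platform) (n : nat) (tau : task_system n).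
Local Notation u := (util tau).
Local Notation e := (wcet tau).
Local Notation p := (period tau).

Lemma util_gt0 i : 0 < u i.
Proof. by rewrite divr_gt0 ?wcet_gt0 ?period_gt0. Qed.

Lemma wcetE i : e i = u i * p i.
Proof. by rewrite divfK // gt_eqF ?period_gt0. Qed.

Lemma p_min_le i : p_min tau <= p i.
Proof. by apply: minl_le; rewrite map_f ?mem_enum. Qed.

Definition rate i : rat := Num.max 1 (u i).

Lemma rate_ge1 i : 1 <= rate i. Proof. by rewrite le_max lexx. Qed.
Lemma rate_gt0 i : 0 < rate i. Proof. exact: lt_le_trans ltr01 (rate_ge1 i). Qed.
Lemma util_le_rate i : u i <= rate i. Proof. by rewrite le_max lexx orbT. Qed.

Lemma rate_le_speed i (q : proc P) : u i <= speed q -> rate i <= speed q.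
Proof. by move=> uq; rewrite ge_max speed_ge1. Qed.

Lemma wcet_le_rate i : e i <= rate i * p i.
Proof. by rewrite wcetE ler_wpM2r ?util_le_rate // ltW ?period_gt0. Qed.

(** The term of [E_bar] for task [i], with [rate i] in place of the speed of the paired
    processor. *)
Definition excess i : rat := e i + u i * (p i - e i / rate i).

Lemma wcet_le_excess i : e i <= excess i.
Proof.
rewrite lerDl mulr_ge0 ?(ltW (util_gt0 i)) // subr_ge0 ler_pdivrMr ?rate_gt0 //.
by rewrite mulrC wcet_le_rate.
Qed.

Lemma excess_ge0 i : 0 <= excess i.
Proof. exact: le_trans (ltW (wcet_gt0 tau i)) (wcet_le_excess i). Qed.

Hypothesis hutil : forall i : 'I_n, u i <= alpha_max P.
Hypothesis hPhi : forall k : 'I_(nkinds P).+1, (k < nkinds P)%N ->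
  (#|Phi tau k| <= #|Psi k|)%N.

(* The [j]-th task by decreasing utilization is paired with the [j]-th fastest
   processor: were it too slow, [Phi k] would be larger than [Psi k] for its
   kind [k]. *)
Lemma exists_pairing (psi : {set 'I_n}) :
  #|psi| = minn n (nproc P).-1 ->
  exists2 f : {ffun 'I_n -> proc P}, pairing psi f &
    {in psi, forall i, u i <= speed (f i)}.
Proof.
move=> hpsi; have [q0 _] := kind_inhabited (@ord0 (nkinds P)).
pose ts := sort (relpre u >=%O) (enum psi).
have ts_mem i : (i \in ts) = (i \in psi) by rewrite mem_sort mem_enum.
have ts_uniq : uniq ts by rewrite sort_uniq enum_uniq.
have ts_sort : sorted (relpre u >=%O) ts by apply: sort_sorted => x y; exact: ge_total.
have utr : transitive (relpre u >=%O) by move=> y x z /= xy yz; exact: le_trans yz xy.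
have urefl : reflexive (relpre u >=%O) by move=> y /=.
pose L := sort (relpre (@speed P) >=%O) (enum (proc P)).
have L_mem q : q \in L by rewrite mem_sort mem_enum.
have L_uniq : uniq L by rewrite sort_uniq enum_uniq.
have L_sort : sorted (relpre (@speed P) >=%O) L by apply: sort_sorted => x y; exact: ge_total.
have str : transitive (relpre (@speed P) >=%O) by move=> y x z /= xy yz; exact: le_trans yz xy.
have srefl : reflexive (relpre (@speed P) >=%O) by move=> y /=.
have fastE : fastest P = take (nproc P).-1 L by [].
have sL : size L = nproc P by rewrite size_sort -cardE.
have sts : (size ts <= (nproc P).-1)%N by rewrite size_sort -cardE hpsi geq_minr.
have idx i : i \in psi -> (index i ts < (nproc P).-1)%N.
  by move=> ipsi; rewrite (leq_trans _ sts) // index_mem ts_mem.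
have fast_uniq : uniq (fastest P) by rewrite fastE take_uniq.
exists [ffun i => nth q0 (fastest P) (index i ts)].
  apply/and3P; split; first exact/eqP.
    by apply/forall_inP => i ipsi; rewrite ffunE mem_nth // size_fastest idx.
  apply/forall_inP => i ipsi; apply/forall_inP => j jpsi; apply/implyP.
  rewrite !ffunE nth_uniq ?size_fastest ?idx // => /eqP ij.
  by rewrite -[i](nth_index i (_ : i \in ts)) ?ts_mem // ij nth_index // ts_mem.
move=> i ipsi; rewrite ffunE fastE nth_take ?idx // leNgt; apply/negP.
set j := index i ts; set q := nth q0 L j => uq.
have jL : (j < size L)%N by rewrite sL (leq_trans (idx i ipsi)) // leq_pred.
have jts : (j < size ts)%N by rewrite index_mem ts_mem.
(* [hPhi] says nothing about the fastest kind; that case is excluded by [hutil]. *)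
have kz : (kind q < nkinds P)%N.
  rewrite ltn_neqAle -ltnS ltn_ord andbT; apply/eqP => qmax.
  have := hutil i; rewrite leNgt => /negP; apply; apply: le_lt_trans uq.
  by rewrite /alpha_max le_alpha // qmax.
have := hPhi kz; rewrite leqNgt => /negP; apply.
(* Processors faster than [q] all come before position [j] in [L], whereas the first [j.+1] tasks of
   [ts] all have utilization above [speed q]. *)
apply: (@leq_trans j.+1).
  have : (size (take j L) <= j)%N by rewrite size_take_min geq_minl.
  rewrite ltnS; apply: leq_trans; apply: leq_trans (card_size _).
  apply/subset_leq_card/fintype.subsetP => q'; rewrite in_Psi => q'q.
  rewrite in_take // ltnNge; apply/negP => jq'.
  have : speed q' <= speed q.
    rewrite -[q'](nth_index q0 (L_mem q')).
    by apply: (sorted_leq_nth str srefl q0 L_sort j (index q' L));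
      rewrite ?inE // index_mem L_mem.
  by rewrite leNgt q'q.
have <- : size (take j.+1 ts) = j.+1 by rewrite size_takel.
rewrite -(card_uniqP _) ?take_uniq //.
apply/subset_leq_card/fintype.subsetP => i' i'ts; rewrite inE; apply: lt_le_trans uq _.
have i'mem := mem_take i'ts; rewrite in_take // ltnS in i'ts.
rewrite -[in leLHS](nth_index i (_ : i \in ts)) ?ts_mem // -[in leRHS](nth_index i i'mem).
by apply: (sorted_leq_nth utr urefl i ts_sort (index i' ts) j); rewrite ?inE // index_mem.
Qed.

Lemma sum_util_le_U_bar (psi : {set 'I_n}) : (#|psi| <= (nproc P).-1)%N ->
  \sum_(i in psi) u i <= U_bar P tau.
Proof. by move=> hpsi; apply: sum_le_take_sort hpsi => i; rewrite ltW ?util_gt0. Qed.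

(** The tasks counted in [U_bar] are paired with distinct processors at least as fast as their
    utilizations, and at least one processor remains unpaired. Hence the denominator in [x_bound] is
    positive. *)
Lemma U_bar_lt : U_bar P tau < R_sum P.
Proof.
rewrite /U_bar sort_map -map_take big_map; set s := take _ _.
have s_uniq : uniq s by rewrite take_uniq ?sort_uniq ?enum_uniq.
pose psi := [set i in s]%SET.
have cpsi : #|psi| = minn n (nproc P).-1.
  rewrite cardsE (card_uniqP s_uniq) size_take_min size_sort -cardE card_ord.
  by rewrite minnC.
have [f fpair fspeed] := exists_pairing cpsi.
have -> : \sum_(j <- s) u j = \sum_(j in psi) u j.
  by rewrite big_uniq //; apply: eq_bigl => j; rewrite inE.
apply: (@le_lt_trans _ _ (\sum_(i in psi) speed (f i))); first exact: ler_sum.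
have finj : {in psi &, injective f}.
  move=> i j ipsi jpsi fij; have /and3P[_ _ /forall_inP/(_ i ipsi)/forall_inP] := fpair.
  by move=> /(_ j jpsi); rewrite fij eqxx /= => /eqP.
rewrite -(big_imset _ finj) /= R_sumE.
have : (#|f @: psi| < #|proc P|)%N.
  rewrite card_in_imset // cpsi -/(nproc P).
  by rewrite (leq_ltn_trans (geq_minr _ _)) // prednK ?nproc_gt0.
move=> lt; have [q qN] : exists q, q \notin (f @: psi)%SET.
  apply/existsP; rewrite -negb_forall; apply/negP => /forallP all.
  by move: lt; rewrite ltnNge => /negP; apply; apply/subset_leq_card/fintype.subsetP.
rewrite [ltRHS](bigID (mem (f @: psi)%SET)) /= ltrDl (bigD1 q) //=.
by rewrite ltr_wpDr ?speed_gt0 // sumr_ge0 // => q' _; exact/ltW/speed_gt0.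
Qed.

(** Enlarge [S] to a set of the size that [pairing] demands. On a paired processor that is fast
    enough, the added terms are nonnegative, and [rate i <= speed (f i)] makes [excess i] at most
    the corresponding term of [E_bar]. *)
Lemma sum_excess_le_E_bar (S : {set 'I_n}) : (#|S| <= (nproc P).-1)%N ->
  \sum_(i in S) excess i <= E_bar P tau.
Proof.
move=> hS; have [|psi Spsi cpsi] := @exists_superset _ S (minn n (nproc P).-1).
  by have := max_card S; rewrite leq_min hS card_ord geq_minl => ->.
have [f fpair fspeed] := exists_pairing cpsi.
apply: (@le_trans _ _ (pairing_value tau psi f)); last first.
  by apply: le_maxl; apply/mapP; exists (psi, f) => //; rewrite mem_filter /= fpair mem_enum.
rewrite /pairing_value [leRHS](big_setID S) /= (finset.setIidPr Spsi).
rewrite -[leLHS]addr0; apply: lerD; last first.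
  apply: sumr_ge0 => i; rewrite inE => /andP[_ /fspeed ui].
  rewrite addr_ge0 ?(ltW (wcet_gt0 _ _)) // mulr_ge0 ?(ltW (util_gt0 _)) //.
  by rewrite subr_ge0 ler_pdivrMr ?speed_gt0 // wcetE mulrC ler_wpM2l // ltW ?period_gt0.
apply: ler_sum => i iS; rewrite lerD2l ler_wpM2l ?(ltW (util_gt0 _)) //.
rewrite lerD2l lerN2 ler_wpM2l ?(ltW (wcet_gt0 _ _)) // lef_pV2 ?posrE ?speed_gt0 ?rate_gt0 //.
by rewrite rate_le_speed // fspeed // (fintype.subsetP Spsi).
Qed.

Lemma x_bound_ge0 : 0 <= x_bound P tau.
Proof. by rewrite le_max lexx. Qed.

(** The value of [x_bound] is chosen for this: clearing the denominator gives
    [E_bar - p_min <= x * (R_sum - U_bar)]. *)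
Lemma sum_lag_le (S : {set 'I_n}) : (#|S| <= (nproc P).-1)%N ->
  \sum_(i in S) (u i * x_bound P tau + excess i)
    <= R_sum P * x_bound P tau + p_min tau.
Proof.
move=> hS; set x := x_bound P tau; rewrite big_split /= -mulr_suml.
have d : 0 < R_sum P - U_bar P tau by rewrite subr_gt0 U_bar_lt.
have : (E_bar P tau - p_min tau) / (R_sum P - U_bar P tau) <= x by rewrite le_max lexx orbT.
rewrite ler_pdivrMr // => hx.
have hU : (\sum_(i in S) u i) * x <= U_bar P tau * x.
  by rewrite ler_wpM2r ?x_bound_ge0 ?sum_util_le_U_bar.
have := sum_excess_le_E_bar hS; move: hx hU; lra.
Qed.

End Tasks.

(** * What the selection rule guarantees about an assignment *)

Section Assigned.
Variables (P : platform) (n : nat) (tau : task_system n).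

Definition runs (A : assignment P n) (J : job n) : Prop := exists q, A q = Some J.

Definition fast_enough (A : assignment P n) : Prop :=
  forall q J, A q = Some J -> util tau J.1 <= speed q.

Lemma put_fast_enough (A : assignment P n) q J : util tau J.1 <= speed q ->
  fast_enough A -> fast_enough (put A q J).
Proof.
by move=> uq fA q' J'; rewrite ffunE; case: eqP => [-> [<-]|_ /fA].
Qed.

Lemma Psi_util (k k' : 'I_(nkinds P).+1) q (v : rat) :
  k' = k.+1 :> nat -> v <= alpha k' -> q \in Psi k -> v <= speed q.
Proof.
move=> kk' vk'; rewrite in_Psi => /lt_alpha kq.
by apply: le_trans vk' _; apply: le_alpha; rewrite kk'.
Qed.

Lemma place_fast_enough A J B : place tau A J B -> fast_enough A -> fast_enough B.
Proof.
elim=> {A J B} [A J q u1 _|A J k k' q kk' /andP[_ uk'] qk _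
  |A J k k' q J' B kk' /andP[_ uk'] _ qk _ _ _ IH].
- by apply: put_fast_enough; rewrite (le_trans u1) ?speed_ge1.
- by apply: put_fast_enough; apply: Psi_util uk' qk.
- by move=> fA; apply: IH; apply: put_fast_enough => //; apply: Psi_util uk' qk.
Qed.

Lemma put_runs (A : assignment P n) q J J' : A q = None ->
  runs (put A q J) J' <-> J' = J \/ runs A J'.
Proof.
move=> Aq; split=> [[q']|[->|[q' Aq']]].
- by rewrite ffunE; case: eqP => [_ [->]|_ Aq']; [left|right; exists q'].
- by exists q; rewrite ffunE eqxx.
- by exists q'; rewrite ffunE; case: eqP => // qq'; move: Aq'; rewrite qq' Aq.
Qed.

(** A displaced job is overwritten in [put A q J], but the recursive placement brings it back. *)
Lemma place_runs A J B : place tau A J B ->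
  forall J', runs B J' <-> J' = J \/ runs A J'.
Proof.
elim=> {A J B} [A J q _ Aq|A J k k' q _ _ _ Aq|A J k k' q K B _ _ _ _ AqK _ _ IH] J'.
- exact: put_runs.
- exact: put_runs.
rewrite IH; split=> [[->|[q']]|[->|[q' Aq']]].
- by right; exists q.
- by rewrite ffunE; case: eqP => [_ [->]|_ Aq']; [left|right; exists q'].
- by right; exists q; rewrite ffunE eqxx.
- have [qq'|qq'] := eqVneq q' q; first by left; move: Aq'; rewrite qq' AqK => -[].
  by right; exists q'; rewrite ffunE (negPf qq').
Qed.

Lemma assignedP s A : assigned tau s A ->
  fast_enough A /\ forall J, runs A J <-> J \in s.
Proof.
elim=> {s A} [|J s A B _ [fA rA] AJB].
  by split=> [q J|J]; rewrite ?ffunE //; split=> // -[q]; rewrite ffunE.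
split=> [|J']; first exact: place_fast_enough AJB fA.
rewrite (place_runs AJB) rA inE; split=> [[->|->]|/predU1P//]; rewrite ?eqxx ?orbT //.
Qed.

End Assigned.

Local Open Scope classical_set_scope.
Local Open Scope ring_scope.

(** * Work as the integral of the speed devoted to a list of jobs *)

Lemma integral_sum_indic d (T : measurableType d) (R : realType)
    (mu : {measure set T -> \bar R}) (D : set T) (I : Type) (s : seq I)
    (w : I -> R) (A : I -> set T) :
  measurable D -> (forall i, measurable (A i)) -> (forall i, 0 <= w i) ->
  (\int[mu]_(t in D) (\sum_(i <- s) w i * \1_(A i) t)%:E =
   \sum_(i <- s) (w i)%:E * mu (A i `&` D))%E.
Proof.
move=> mD mA w0.
under eq_integral do rewrite -sumEFin.
rewrite ge0_integral_sum //=; last 2 first.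
- move=> i; apply/measurable_EFinP.
  by apply: measurable_funM => //; exact: measurable_indic.
- by move=> i x _; rewrite lee_fin mulr_ge0 // indicE ler0n.
apply: eq_bigr => i _.
under eq_integral do rewrite EFinM.
rewrite ge0_integralZl_EFin ?integral_indic //.
by apply/measurable_EFinP; exact: measurable_indic.
Qed.

Section Work.
Variables (R : realType) (P : platform) (n : nat) (sched : R -> assignment P n).
Hypothesis msched : measurable_schedule sched.
Local Notation mu := (@lebesgue_measure R).
Local Notation W := (work sched).

Definition load (G : seq (job n)) (t : R) : R :=
  \sum_(J <- G) \sum_(q : proc P) ratr (speed q) * (sched t q == Some J)%:R.

(** Run sets contain only nonnegative times, so a bound from above confines them to [[0, a]].
    Finiteness ensures that [fine] in [work] loses nothing. *)
Lemma measure_run_fin J q (A : set R) (a : R) : measurable A ->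
  A `<=` [set s | s < a] -> (mu (run_set sched J q `&` A) < +oo)%E.
Proof.
move=> mA Aa; apply: (@le_lt_trans _ _ (mu `[0, a])); last first.
  by rewrite lebesgue_measure_itv /=; case: ifP => _; rewrite ltry.
apply: le_measure; rewrite ?inE //; first exact: measurableI (msched J q) mA.
by move=> s [[s0 _] /Aa/= sa]; rewrite /= in_itv /= s0 ltW.
Qed.

Lemma work_increment J (a b : R) : a <= b ->
  W J b - W J a =
  \sum_(q : proc P) ratr (speed q) * fine (mu (run_set sched J q `&` `]a, b[)).
Proof.
move=> ab; rewrite /work -sumrB; apply: eq_bigr => q _; rewrite -mulrBr; congr (_ * _).
set A := run_set sched J q; have mA : measurable (A : set (measurableTypeR R)) := msched J q.
have lt_itv (c : R) : [set s | s < c] = [set` `]-oo, c[].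
  by apply/seteqP; split=> s; rewrite /= in_itv.
rewrite !lt_itv.
have fin (B : set R) : measurable B -> B `<=` [set s | s < b] -> mu (A `&` B) \is a fin_num.
  by move=> mB Bb; rewrite ge0_fin_numE // (measure_run_fin J q mB Bb).
have -> : mu (A `&` `]-oo, b[) = (mu (A `&` `]-oo, a[) + mu (A `&` `[a, b[))%E.
  rewrite -measureU; [|exact: measurableI|exact: measurableI|]; last first.
    apply/seteqP; split=> // s [[_ /= +] [_ /=]]; rewrite !in_itv /= => sa /andP[as_ _].
    by move: sa; rewrite ltNge as_.
  congr (mu _); rewrite -setIUr; congr (_ `&` _).
  apply/seteqP; split=> s /=; rewrite !in_itv /=.
    by move=> ->; case: (ltP s a); [left|right].
  by case=> [sa|/andP[_ //]]; exact: lt_le_trans sa ab.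
(* The point [a] is a null set; dropping it lets later bounds on the load be checked on an open
   interval only. *)
have -> : mu (A `&` `[a, b[) = mu (A `&` `]a, b[).
  apply/eqP; rewrite eq_le; apply/andP; split; last first.
    apply: le_measure; rewrite ?inE; [exact: measurableI|exact: measurableI|].
    by apply: setIS => s /=; rewrite !in_itv /= => /andP[/ltW -> ->].
  apply: (@le_trans _ _ (mu (A `&` `]a, b[) + mu [set a])%E); last first.
    by rewrite lebesgue_measure_set1 adde0.
  apply: le_trans (measureU2 mu _ _); [|exact: measurableI|exact: measurable_set1].
  apply: le_measure; rewrite ?inE; [exact: measurableI| |].
    by apply: measurableU; [exact: measurableI|exact: measurable_set1].
  move=> s [As /=]; rewrite in_itv /= le_eqVlt => /andP[/orP[/eqP->|as_] sb]; [by right|left].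
  by split=> //=; rewrite in_itv /= as_.
rewrite fineD; last 2 first.
- by apply: fin => // s /=; rewrite in_itv /= => sa; exact: lt_le_trans sa ab.
- by apply: fin => // s /=; rewrite in_itv /= => /andP[].
by rewrite addrC addKr.
Qed.

Lemma loadE G (t : R) : 0 <= t ->
  load G t = \sum_(J <- G) \sum_(q : proc P)
    ratr (speed q) * \1_(run_set sched J q) t.
Proof.
move=> t0; apply: eq_bigr => J _; apply: eq_bigr => q _; congr (_ * _).
rewrite indicE; congr (_%:R : R); congr nat_of_bool; apply/eqP/idP.
  by move=> tJ; rewrite inE.
by rewrite inE => -[].
Qed.

Lemma measurable_load G (a b : R) : 0 <= a ->
  measurable_fun (`]a, b[ : set (measurableTypeR R)) (load G).
Proof.
move=> a0.
pose f (t : measurableTypeR R) : R := \sum_(J <- G) \sum_(q : proc P)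
    ratr (speed q) * \1_(run_set sched J q) t.
apply: (@eq_measurable_fun _ _ _ _ _ f).
  by move=> t; rewrite inE /= in_itv /= => /andP[at_ _]; rewrite loadE // (le_trans a0) ?ltW.
apply: measurable_sum => J; apply: measurable_sum => q.
by apply: measurable_funM => //; apply: measurable_indic; exact: msched.
Qed.

(** The measure of a run set is the integral of its indicator. Pointwise bounds on [load] thereby
    become bounds on the growth of work. *)
Lemma work_load G (a b : R) : 0 <= a -> a <= b ->
  ((\sum_(J <- G) (W J b - W J a))%:E = \int[mu]_(t in `]a, b[) (load G t)%:E)%E.
Proof.
move=> a0 ab.
pose w (Jq : job n * proc P) : R := ratr (speed Jq.2).
pose A (Jq : job n * proc P) : set R := run_set sched Jq.1 Jq.2.
pose s := [seq (J, q) | J <- G, q <- index_enum (proc P)].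
transitivity (\int[mu]_(t in `]a, b[) (\sum_(i <- s) w i * \1_(A i) t)%:E)%E; last first.
  apply: eq_integral => t; rewrite inE /= in_itv /= => /andP[at_ _]; congr EFin.
  by rewrite big_allpairs loadE // (le_trans a0) ?ltW.
rewrite integral_sum_indic //; last 2 first.
- by move=> i; exact: msched.
- by move=> i; rewrite ler0q ltW ?speed_gt0.
rewrite big_allpairs -sumEFin; apply: eq_bigr => J _; rewrite work_increment // -sumEFin.
apply: eq_bigr => q _; rewrite EFinM fineK // ge0_fin_numE //.
apply: (@measure_run_fin _ _ _ b); first exact: measurable_itv.
by move=> s' /=; rewrite in_itv /= => /andP[].
Qed.

Lemma load_ge0 G t : 0 <= load G t.
Proof.
apply: sumr_ge0 => J _; apply: sumr_ge0 => q _.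
by rewrite mulr_ge0 ?ler0n // ler0q ltW ?speed_gt0.
Qed.

Lemma integral_cst_itv (v a b : R) : a <= b ->
  (\int[mu]_(t in `]a, b[) v%:E = (v * (b - a))%:E)%E.
Proof.
move=> ab; rewrite [LHS]integral_cst //= lebesgue_measure_itv /=; case: ifPn => [_|].
  by rewrite -EFinB -EFinM.
by rewrite -leNgt lee_fin => ba; rewrite (le_anti (_ : a <= b <= a)) ?ab // subrr mulr0 mule0.
Qed.

Lemma work_growth_ge G (v a b : R) : 0 <= a -> a <= b -> 0 <= v ->
  (forall t, a < t < b -> v <= load G t) ->
  v * (b - a) <= \sum_(J <- G) (W J b - W J a).
Proof.
move=> a0 ab v0 hv; rewrite -lee_fin work_load // -integral_cst_itv //.
apply: ge0_le_integral => //.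
by apply/measurable_EFinP; apply: measurable_load.
Qed.

Lemma work_growth_le G (v a b : R) : 0 <= a -> a <= b -> 0 <= v ->
  (forall t, a < t < b -> load G t <= v) ->
  \sum_(J <- G) (W J b - W J a) <= v * (b - a).
Proof.
move=> a0 ab v0 hv; rewrite -lee_fin work_load // -integral_cst_itv //.
apply: ge0_le_integral => //.
  by move=> t _; rewrite lee_fin load_ge0.
by apply/measurable_EFinP; apply: measurable_load.
Qed.

Lemma work0 J : W J 0 = 0.
Proof.
rewrite /work big1 // => q _.
rewrite (_ : _ `&` _ = set0) ?measure0 ?mulr0 //.
by apply/seteqP; split=> // s [[s0 _]] /=; rewrite ltNge s0.
Qed.

Lemma work_le J (a b : R) : 0 <= a -> a <= b -> W J a <= W J b.
Proof.
move=> a0 ab; have := @work_growth_ge [:: J] 0 a b a0 ab (lexx _).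
rewrite mul0r big_seq1 subr_ge0; apply=> t _; exact: load_ge0.
Qed.

Lemma work_ge0 J t : 0 <= t -> 0 <= W J t.
Proof. by move=> t0; rewrite -(work0 J) work_le. Qed.

Lemma load_le_R_sum J t : load [:: J] t <= ratr (R_sum P).
Proof.
rewrite R_sumE raddf_sum /load big_seq1; apply: ler_sum => q _.
by rewrite ler_piMr ?lern1 ?leq_b1 // ler0q ltW ?speed_gt0.
Qed.

Lemma work_lipschitz J (a b : R) : 0 <= a -> a <= b ->
  W J b <= W J a + ratr (R_sum P) * (b - a).
Proof.
move=> a0 ab; rewrite -lerBlDl.
have := @work_growth_le [:: J] (ratr (R_sum P)) a b a0 ab.
rewrite big_seq1; apply => [|t _]; last exact: load_le_R_sum.
by rewrite ler0q (le_trans ler01) ?R_sum_ge1.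
Qed.

End Work.

(** Take [b] to be the supremum of the times with [f <= B]. Since [f] rises at rate at most [L], the
    bound passes from times just before the supremum to the supremum itself. *)
Lemma last_below (R : realType) (f : R -> R) (L a t B : R) :
  0 <= L -> a <= t ->
  (forall y z, a <= y -> y <= z -> f z <= f y + L * (z - y)) ->
  f a <= B ->
  exists b, [/\ a <= b, b <= t, f b <= B & forall s, b < s <= t -> B < f s].
Proof.
move=> L0 at_ Lf faB.
pose S : set R := [set s | a <= s /\ s <= t /\ f s <= B].
have Sa : S a by split.
have Sub : ubound S t by move=> s [_ []].
have supS : has_sup S by split; [exists a|exists t].
have a_sup : a <= sup S by apply: ub_le_sup => //; exists t.
exists (sup S); split => //; first by apply: ge_sup => //; exists a.
  apply/ler_addgt0Pr => e e0.
  (* Dividing by [L + 1] covers the case [L = 0]. *)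
  have d0 : 0 < e / (L + 1) by rewrite divr_gt0 ?ltr_wpDl.
  have [s [as_ [st fs]] se] := sup_adherent d0 supS.
  have s_sup : s <= sup S by apply: ub_le_sup; [exists t|].
  apply: le_trans (Lf _ _ as_ s_sup) _; apply: lerD => //.
  apply: (@le_trans _ _ (L * (e / (L + 1)))).
    by rewrite ler_wpM2l // ltW // ltrBlDl addrC -ltrBlDl.
  by rewrite mulrA ler_pdivrMr ?ltr_wpDl // mulrC ler_wpM2l ?lerDl // ltW.
move=> s /andP[ss st]; rewrite ltNge; apply/negP => fs.
have : s <= sup S by apply: ub_le_sup; [exists t|split; [exact: le_trans a_sup (ltW ss)|]].
by rewrite leNgt ss.
Qed.

Section Load.
Variables (R : realType) (P : platform) (n : nat) (sched : R -> assignment P n).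

Lemma speed_le_load (G : seq (job n)) t q J : J \in G -> sched t q = Some J ->
  ratr (speed q) <= load sched G t.
Proof.
move=> JG tJ; rewrite /load (perm_big _ (perm_to_rem JG)) big_cons (bigD1 q) //= tJ eqxx mulr1.
rewrite -addrA lerDl addr_ge0 ?load_ge0 // sumr_ge0 // => q' _.
by rewrite mulr_ge0 ?ler0n // ler0q ltW ?speed_gt0.
Qed.

Lemma R_sum_le_load (G : seq (job n)) t :
  (forall q, exists2 J, J \in G & sched t q = Some J) ->
  ratr (R_sum P) <= load sched G t.
Proof.
move=> hG; rewrite R_sumE raddf_sum /load exchange_big; apply: ler_sum => q _ /=.
have [J JG tJ] := hG q; rewrite (perm_big _ (perm_to_rem JG)) big_cons tJ eqxx mulr1 lerDl.
by apply: sumr_ge0 => J' _; rewrite mulr_ge0 ?ler0n // ler0q ltW ?speed_gt0.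
Qed.

End Load.

(** * Releases, deadlines, completion and enabled jobs *)

Section Schedule.
Variables (R : realType) (P : platform) (n : nat) (tau : task_system n).
Variables (r c : 'I_n -> nat -> R) (sched : R -> assignment P n).
Hypothesis hr : sporadic_releases tau r.
Hypothesis hc : bounded_workloads tau c.
Hypothesis hS : gedfh_schedule tau r c sched.

Local Notation U i := (ratr (util tau i) : R).
Local Notation E i := (ratr (wcet tau i) : R).
Local Notation p i := (ratr (period tau i) : R).
Local Notation W := (work sched).
Local Notation d := (deadline tau r).
Local Notation compl := (completed r c sched).
Local Notation enab := (enabled r c sched).
Local Notation m := (nproc P).

Definition rem (J : job n) (t : R) : R := c J.1 J.2 - W J t.

Let msched : measurable_schedule sched. Proof. by case: hS. Qed.

Lemma period_gt0R i : 0 < p i. Proof. by rewrite ltr0q period_gt0. Qed.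

Lemma release_ge0 i k : 0 <= r i k. Proof. by case: (hr i k). Qed.

Lemma releaseD i k l : r i k + l%:R * p i <= r i (k + l)%N.
Proof.
elim: l => [|l IH]; first by rewrite mul0r addr0 addn0.
by have [_] := hr i (k + l); rewrite addnS mulrSr mulrDl mul1r; move: IH; lra.
Qed.

Lemma release_le i k k' : (k <= k')%N -> r i k <= r i k'.
Proof.
move=> /subnKC <-; apply: le_trans (releaseD _ _ _).
by rewrite lerDl mulr_ge0 // ltW ?period_gt0R.
Qed.

Lemma deadline_le i k k' : (k <= k')%N -> d (i, k) <= d (i, k').
Proof. by move=> kk'; rewrite /deadline lerD2r release_le. Qed.

Lemma release_lt_deadline J : r J.1 J.2 < d J.
Proof. by rewrite /deadline ltrDl period_gt0R. Qed.

Lemma deadline_ge0 J : 0 <= d J.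
Proof. by rewrite (le_trans _ (ltW (release_lt_deadline J))) ?release_ge0. Qed.

(** Deadlines of one task increase by at least a period per job, so those up to [D] form a finite
    initial segment. *)
Lemma exists_njobs (D : R) i : exists K, forall k, (k < K)%N = (d (i, k) <= D).
Proof.
have exK : exists k, D < d (i, k).
  have [k Dk] : exists k : nat, D / p i < k%:R.
    by exists (Num.truncn (D / p i)).+1; exact: truncnS_gt.
  exists k; rewrite ltr_pdivrMr ?period_gt0R // in Dk.
  apply: lt_le_trans Dk _; rewrite /deadline /=.
  have := releaseD i 0 k; rewrite add0n.
  have := release_ge0 i 0; have := period_gt0R i; lra.
exists (ex_minn exK) => k; case: ex_minnP => K DK Kmin.
apply/idP/idP => [kK|kD].
  by rewrite leNgt; apply/negP => /Kmin; rewrite leqNgt kK.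
rewrite ltnNge; apply/negP => /(deadline_le i) Kk.
by have := lt_le_trans DK (le_trans Kk kD); rewrite ltxx.
Qed.

Definition njobs (D : R) i : nat :=
  xget 0%N [set K | forall k, (k < K)%N = (d (i, k) <= D)].

Lemma njobsP D i k : (k < njobs D i)%N = (d (i, k) <= D).
Proof.
rewrite /njobs; case: xgetP => [K _ ->//|]; have [K hK] := exists_njobs D i.
by move=> /(_ K).
Qed.

Definition jobs_upto (D : R) : seq (job n) :=
  [seq (i, k) | i <- enum 'I_n, k <- index_iota 0 (njobs D i)].

Lemma mem_jobs_upto D J : (J \in jobs_upto D) = (d J <= D).
Proof.
case: J => i k; apply/allpairsPdep/idP => [[i' [k' [_ + [-> ->]]]]|iD].
  by rewrite mem_index_iota njobsP => /andP[].
by exists i, k; rewrite mem_enum mem_index_iota njobsP.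
Qed.

Lemma uniq_jobs_upto D : uniq (jobs_upto D).
Proof.
apply: allpairs_uniq_dep => [|i _|]; rewrite ?enum_uniq ?iota_uniq //.
by move=> [i k] [i' k'] _ _ /= [-> ->].
Qed.

(** Real deadlines are not well-founded; this count of jobs serves as the measure for the induction
    on deadlines. *)
Lemma size_jobs_upto_lt D J : D < d J -> (size (jobs_upto D) < size (jobs_upto (d J)))%N.
Proof.
move=> DJ; apply: (@uniq_leq_size _ (J :: jobs_upto D)).
  by rewrite /= uniq_jobs_upto mem_jobs_upto -ltNge DJ.
move=> J'; rewrite inE => /predU1P[->|]; rewrite !mem_jobs_upto // => /le_trans; apply.
exact: ltW.
Qed.

Lemma sum_jobs_upto D (F : job n -> R) :
  \sum_(J <- jobs_upto D) F J = \sum_i \sum_(0 <= k < njobs D i) F (i, k).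
Proof. by rewrite big_allpairs_dep big_enum. Qed.

(** The releases of jobs [k] to [njobs D i - 1] are a period apart, and the last of these jobs still
    has a full period before its deadline, which is at most [D]. *)
Lemma njobs_period_le D i k : (k <= njobs D i)%N -> r i k <= D ->
  (njobs D i - k)%:R * p i <= D - r i k.
Proof.
rewrite leq_eqVlt => /predU1P[->|kK] kD; first by rewrite subnn mul0r subr_ge0.
have : d (i, (njobs D i).-1) <= D by rewrite -njobsP prednK // (leq_ltn_trans _ kK).
rewrite /deadline /=; have := releaseD i k ((njobs D i).-1 - k).
have kK' : (k <= (njobs D i).-1)%N by lia.
rewrite subnKC //.
have -> : (njobs D i - k = ((njobs D i).-1 - k).+1)%N by lia.
by rewrite mulrSr mulrDl mul1r; lra.
Qed.

Lemma workload_le i k : c i k <= E i. Proof. by case/andP: (hc i k). Qed.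

Lemma rem_le_wcet J t : 0 <= t -> rem J t <= E J.1.
Proof.
move=> t0; rewrite /rem; have := workload_le J.1 J.2; have := work_ge0 msched J t0; lra.
Qed.

Lemma rem_le J s t : 0 <= s -> s <= t -> rem J t <= rem J s.
Proof. by move=> s0 st; rewrite lerD2l lerN2 work_le. Qed.

Lemma completed_le J s t : 0 <= s -> s <= t -> compl J s -> compl J t.
Proof.
move=> s0 st Js k /Js[rk ck]; split; first exact: le_trans st.
exact: le_trans ck (work_le msched _ s0 st).
Qed.

Lemma completed_rem_le0 J t : compl J t -> rem J t <= 0.
Proof. by case: J => i k /(_ k (leqnn _)) [_ ck]; rewrite subr_le0. Qed.

Lemma completed_prefix i k k' t : (k' <= k)%N -> compl (i, k) t -> compl (i, k') t.
Proof. by move=> kk' ik l lk'; apply: ik; exact: leq_trans kk'. Qed.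

Lemma completedI J t : r J.1 J.2 <= t -> (forall k, J.2 = k.+1 -> compl (J.1, k) t) ->
  rem J t <= 0 -> compl J t.
Proof.
case: J => i k /= rk pred remJ l; rewrite leq_eqVlt => /predU1P[->|].
  by split=> //; rewrite -subr_le0.
by case: k rk pred remJ => // k rk /(_ _ erefl) pred _; rewrite ltnS; exact: pred.
Qed.

Lemma enabled_uniq i k k' t : enab t (i, k) -> enab t (i, k') -> k = k'.
Proof.
wlog kk' : k k' / (k < k')%N => [hw|] ik ik'.
  by case: (ltngtP k k') => // ?; [|apply/esym]; exact: hw.
have [_ notk _] := ik; have [_ _] := ik'; case: k' kk' {ik'} => // k' kk' /(_ _ erefl) predk'.
by case: notk; apply: completed_prefix predk'.
Qed.

(** The first incomplete job of the task is enabled: it is released no later than job [k], and its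
    predecessor is complete by minimality. *)
Lemma exists_enabled i k t : r i k <= t -> ~ compl (i, k) t ->
  exists2 k', (k' <= k)%N & enab t (i, k').
Proof.
move=> rk notk; have exk : exists k, ~~ `[< compl (i, k) t >] by exists k; apply/asboolPn.
have [k' /asboolPn notk' k'min] := ex_minnP exk.
have k'k : (k' <= k)%N by apply: k'min; apply/asboolPn.
exists k' => //; split=> // [|l /= k'l]; first exact: le_trans (release_le i k'k) rk.
apply/asboolP; rewrite -[X in is_true X]negbK; apply/negP => /k'min.
by rewrite k'l ltnn.
Qed.

Lemma runsP t : 0 <= t ->
  fast_enough tau (sched t) /\
  forall J, runs (sched t) J <-> selected tau r c sched t J.
Proof.
move=> t0; have [_ /(_ t t0)[s [_ sP /assignedP[fA rA]]]] := hS.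
by split=> // J; rewrite rA sP.
Qed.

Lemma runs_enabled t J : 0 <= t -> runs (sched t) J -> enab t J.
Proof. by move=> t0 /(runsP t0).2[]. Qed.

(** Let [b] be the last time at which the work done is at most the workload. Were the job running
    after [b], it would be both enabled and completed, so it receives nothing between [b] and
    [t]. *)
Lemma rem_ge0 J t : 0 <= t -> 0 <= rem J t.
Proof.
move=> t0; rewrite subr_ge0; set C := c J.1 J.2.
have C0 : W J 0 <= C by rewrite work0 //; case/andP: (hc J.1 J.2).
have R0 : 0 <= ratr (R_sum P) :> R by rewrite ler0q (le_trans ler01) ?R_sum_ge1.
have [b [b0 bt bC btC]] := last_below R0 t0 (fun y z => work_lipschitz msched J (b:=z)) C0.
apply: le_trans bC; rewrite -subr_le0 -(mul0r (t - b)).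
have := @work_growth_le _ _ _ _ msched [:: J] 0 b t b0 bt (lexx _).
rewrite big_seq1; apply=> s /andP[bs st].
rewrite /load big_seq1 big1 // => q _; case: eqP => [sJ|]; last by rewrite mulr0.
have s0 : 0 <= s by rewrite (le_trans b0) ?ltW.
have [rJ notJ predJ] := runs_enabled s0 (ex_intro _ q sJ).
case: notJ; apply: completedI => //; rewrite subr_le0 ltW // btC // bs ltW //.
Qed.


(** * Tasks with an enabled urgent job, and how their number governs execution *)

Definition active (D t : R) : {set 'I_n} :=
  [set i | `[< exists2 k, d (i, k) <= D & enab t (i, k) >]]%SET.

Lemma activeI D t i k : d (i, k) <= D -> enab t (i, k) -> i \in active D t.
Proof. by move=> ik ek; rewrite inE; apply/asboolP; exists k. Qed.

Lemma activeP D t i : i \in active D t -> exists2 k, d (i, k) <= D & enab t (i, k).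
Proof. by rewrite inE => /asboolP. Qed.

(** A task has at most one enabled job, so sending a job to its task is injective on the competitors
    of [J]. Positions in [enum A] turn this into an injection into an initial segment of the
    naturals. *)
Lemma selectedI t J (A : {set 'I_n}) : enab t J -> (#|A| <= m.-1)%N ->
  (forall J', enab t J' -> higher_priority tau r J' J -> J'.1 \in A) ->
  selected tau r c sched t J.
Proof.
move=> eJ Am hA; split=> //; set B := [set J' | _].
pose f (J' : job n) := index J'.1 (enum A).
have finj : {in B &, injective f}.
  move=> [i k] [i' k']; rewrite !inE => -[ek /(hA _ ek) iA] [ek' /(hA _ ek') i'A] /=.
  move=> /(@index_inj _ i _ i i'); rewrite !mem_enum => /(_ iA i'A) ii'.
  rewrite -ii' in ek' *.
  by rewrite (enabled_uniq ek ek').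
rewrite -(card_le_eql (inj_card_eq finj)); apply: subset_card_le => _ [J' [eJ' hJ'] <-] /=.
by apply: leq_trans Am; rewrite /f cardE index_mem mem_enum hA.
Qed.

(** Whatever has priority over an urgent job is itself urgent, so [active D t] contains the tasks of
    all competitors. *)
Lemma few_active_runs D t J : 0 <= t -> (#|active D t| <= m.-1)%N ->
  d J <= D -> enab t J -> runs (sched t) J.
Proof.
move=> t0 fewD JD eJ; apply/(runsP t0).2; apply: (selectedI eJ fewD) => -[i k] ek hk.
by apply: activeI ek; apply: le_trans JD; case: hk => [/ltW//|[-> _]].
Qed.

Lemma card_running t q0 (A : {set 'I_n}) :
  (forall i, i \in A -> exists k q, q != q0 /\ sched t q = Some (i, k)) ->
  (#|A| <= m.-1)%N.
Proof.
move=> hA; rewrite -(card_imset _ (@Some_inj _)).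
have -> : m.-1 = #|[set~ q0]%SET| by rewrite cardsC1.
apply: leq_trans (leq_imset_card (fun q => omap fst (sched t q)) _).
apply/subset_leq_card/fintype.subsetP => _ /imsetP[i /hA[k [q [qq0 tq]]] ->].
by apply/imsetP; exists q; rewrite ?tq // !inE.
Qed.

Lemma higher_priority_trans J1 J2 J3 : higher_priority tau r J1 J2 ->
  higher_priority tau r J2 J3 -> higher_priority tau r J1 J3.
Proof.
case=> [lt12|[eq12 i12]] [lt23|[eq23 i23]].
- by left; exact: lt_trans lt12 lt23.
- by left; rewrite -eq23.
- by left; rewrite eq12.
- by right; split; [rewrite eq12|exact: ltn_trans i12 i23].
Qed.

Lemma higher_priority_irr J : ~ higher_priority tau r J J.
Proof. by case=> [|[_]]; rewrite ?ltxx ?ltnn. Qed.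

Lemma higher_priority_deadline J J' : higher_priority tau r J J' -> d J <= d J'.
Proof. by case=> [/ltW//|[-> _]]. Qed.

(* If some processor is free of urgent jobs, then by induction on the priority
   all enabled urgent jobs are selected. *)
Lemma busy_or_few D t : 0 <= t ->
  (forall q, exists2 J, J \in jobs_upto D & sched t q = Some J) \/
  (#|active D t| <= m.-1)%N.
Proof.
move=> t0; case: (pselect (forall q, exists2 J, J \in jobs_upto D & sched t q = Some J)).
  by left.
move=> /existsNP[q0 q0P]; right.
have away J q : d J <= D -> sched t q = Some J -> q != q0.
  by move=> JD tq; apply/eqP => qq0; apply: q0P; exists J; rewrite ?mem_jobs_upto // -qq0.
pose A J : {set 'I_n} :=
  [set i | `[< exists2 k, enab t (i, k) & higher_priority tau r (i, k) J >]]%SET.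
suff all_run J : enab t J -> d J <= D -> runs (sched t) J.
  apply: (@card_running t q0) => i /activeP[k kD /all_run /(_ kD)[q tq]].
  by exists k, q; split=> //; exact: away tq.
(* The measure counts the tasks with a job ahead of [J]. By induction these jobs all run away from
   [q0], so there are at most [m - 1] of them. *)
have [N] := ubnP #|A J|; elim: N J => // N IH J AJN eJ JD.
apply/(runsP t0).2; apply: (@selectedI _ _ (A J)) => //; last first.
  by move=> [i k] ek hk; rewrite inE; apply/asboolP; exists k.
apply: (@card_running t q0) => i; rewrite inE => /asboolP[k ek hk].
have kD : d (i, k) <= D by exact: le_trans (higher_priority_deadline hk) JD.
suff [q tq] : runs (sched t) (i, k) by exists k, q; split=> //; exact: away tq.
apply: IH => //; rewrite -ltnS; apply: leq_trans AJN; rewrite ltnS.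
apply/proper_card/properP; split.
  apply/fintype.subsetP => i'; rewrite inE => /asboolP[k' ek' hk']; rewrite inE.
  by apply/asboolP; exists k'; last exact: (higher_priority_trans hk' hk).
exists i; rewrite inE; first by apply/asboolP; exists k.
apply/asboolP => -[k' ek' hk']; rewrite (enabled_uniq ek ek') in hk'.
exact: higher_priority_irr hk'.
Qed.

(** All urgent jobs are released by [D], so a task with an urgent job left at [t] already had that
    job or an earlier one enabled at [s]. *)
Lemma active_le D s t : D <= s -> s <= t -> active D t \subset active D s.
Proof.
move=> Ds st; apply/fintype.subsetP => i /activeP[k kD [_ notk _]].
have s0 : 0 <= s by apply: le_trans Ds; apply: le_trans kD; exact: deadline_ge0.
have [||k' k'k ek'] := @exists_enabled i k s.
- by apply: le_trans Ds; apply: le_trans kD; exact/ltW/(release_lt_deadline (i, k)).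
- by move=> ks; apply: notk; exact: completed_le st ks.
- by apply: activeI ek'; apply: le_trans kD; exact: deadline_le.
Qed.


(** * Lag of single tasks and the urgent work left at a deadline *)

Hypothesis hutil : forall i : 'I_n, util tau i <= alpha_max P.
Hypothesis hPhi : forall k : 'I_(nkinds P).+1, (k < nkinds P)%N ->
  (#|Phi tau k| <= #|Psi k|)%N.
Hypothesis hU : U_sum tau <= R_sum P.

Local Notation x := (ratr (x_bound P tau) : R).
Local Notation v i := (ratr (rate tau i) : R).
Local Notation b i := (ratr (excess tau i) : R).
Local Notation Rs := (ratr (R_sum P) : R).
Local Notation pm := (ratr (p_min tau) : R).

Lemma x_ge0R : 0 <= x. Proof. by rewrite ler0q x_bound_ge0. Qed.
Lemma utilR_ge0 i : 0 <= U i. Proof. by rewrite ler0q ltW ?util_gt0. Qed.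
Lemma wcetRE i : E i = U i * p i. Proof. by rewrite -rmorphM -wcetE. Qed.
Lemma rateR_gt0 i : 0 < v i. Proof. by rewrite ltr0q rate_gt0. Qed.
Lemma utilR_le_rate i : U i <= v i. Proof. by rewrite ler_rat util_le_rate. Qed.
Lemma wcetR_le_rate i : E i <= v i * p i.
Proof. by rewrite -rmorphM ler_rat wcet_le_rate. Qed.
Lemma wcetR_le_excess i : E i <= b i. Proof. by rewrite ler_rat wcet_le_excess. Qed.
Lemma excessR i : b i = E i + U i * (p i - E i / v i).
Proof. by rewrite -fmorph_div -rmorphB -rmorphM -rmorphD. Qed.

Lemma rateR_le_speed t J q : 0 <= t -> sched t q = Some J -> v J.1 <= ratr (speed q).
Proof.
by move=> t0 tq; rewrite ler_rat rate_le_speed //; exact: (runsP t0).1 tq.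
Qed.

Lemma rateR_le_R_sum i : v i <= Rs.
Proof.
by rewrite ler_rat ge_max R_sum_ge1 (le_trans (hutil i)) ?alpha_max_le_R_sum.
Qed.

Definition on_time (J : job n) : Prop := forall s, 0 <= s <= p J.1 ->
  rem J (d J + x + s) <= v J.1 * (p J.1 - s).

Lemma on_time_completed i k t : (forall k', (k' <= k)%N -> on_time (i, k')) ->
  d (i, k) + x + p i <= t -> compl (i, k) t.
Proof.
move=> ot ikt l lk; have := period_gt0R i; have := x_ge0R.
have dl := deadline_le i lk; have dl0 := deadline_ge0 (i, l).
have rl := release_lt_deadline (i, l); move=> /= in rl.
move=> x0 p0; split; first by move: rl => /=; lra.
have := ot l lk (p i); rewrite /= subrr mulr0 lexx ltW // => /(_ isT).
rewrite subr_le0 => /le_trans; apply; apply: work_le => //; lra.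
Qed.

(** At [t = d + x + s] with [s >= 0], the remaining work is at most both [e] and [v * (p - s)].
    Adding [u * s] to the smaller bound gives a maximum where the two meet, at [s = p - e / v],
    because [u <= v]; this is the origin of [excess]. *)
Lemma enabled_lag D t i k : 0 <= t -> t <= D ->
  (forall J, d J < D -> on_time J) -> enab t (i, k) ->
  rem (i, k) t + U i * (t - d (i, k)) <= U i * x + b i.
Proof.
move=> t0 tD ot ek; have U0 := utilR_ge0 i; have x0 := x_ge0R.
have remE := rem_le_wcet (i, k) t0; move=> /= in remE.
have Eb := wcetR_le_excess i.
have [tdx|tdx] := leP t (d (i, k) + x).
  have : U i * (t - d (i, k)) <= U i * x by rewrite ler_wpM2l // lerBlDl.
  lra.
have otk : on_time (i, k) by apply: ot; lra.
pose s := t - d (i, k) - x; have ts : t = d (i, k) + x + s by rewrite /s; ring.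
have s0 : 0 <= s by rewrite /s; lra.
have [sp|sp] := leP s (p i); last first.
  case: ek => _ notk _; case: notk; apply: on_time_completed; last by rewrite ts; lra.
  move=> k' k'k; apply: ot; have := deadline_le i k'k; lra.
have := otk s; rewrite -ts s0 sp => /(_ isT) /= rems.
have v0 := rateR_gt0 i; have Uv := utilR_le_rate i.
have -> : U i * (t - d (i, k)) = U i * x + U i * s by rewrite /s; ring.
rewrite excessR; set y := E i / v i.
have [sy|sy] := leP s (p i - y).
  have : U i * s <= U i * (p i - y) by rewrite ler_wpM2l.
  lra.
have Ey : E i = v i * y by rewrite /y mulrC divfK // gt_eqF.
have : 0 <= (v i - U i) * (y - (p i - s)) by rewrite mulr_ge0 ?subr_ge0 //; lra.
rewrite Ey; lra.
Qed.

(** Split at the first incomplete job [k]. If it is unreleased, all remaining jobs fit into [D - t]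
    at utilization [u]. Otherwise it is enabled, the later jobs fit into [D - d (i, k)], and
    [enabled_lag] accounts for job [k]. *)
Lemma task_demand D t i : 0 <= t -> t <= D ->
  (forall J, d J < D -> on_time J) ->
  \sum_(0 <= k < njobs D i) rem (i, k) t <=
  U i * (D - t) + (i \in active D t)%:R * (U i * x + b i).
Proof.
move=> t0 tD ot; set K := njobs D i.
have U0 := utilR_ge0 i; have x0 := x_ge0R; have p0 := period_gt0R i.
have ext0 : 0 <= U i * x + b i.
  by apply: addr_ge0; [exact: mulr_ge0|rewrite ler0q excess_ge0].
have ext1 : 0 <= (i \in active D t)%:R * (U i * x + b i) by rewrite mulr_ge0.
have [notall|all] := pselect (exists k, `[< (k < K)%N /\ ~ compl (i, k) t >]); last first.
  apply: (@le_trans _ _ 0); last by rewrite addr_ge0 // mulr_ge0 // subr_ge0.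
  rewrite big_nat sumr_le0 // => k /andP[_ kK]; apply: completed_rem_le0.
  by apply: contrapT => notk; apply: all; exists k; exact/asboolP.
have [k /asboolP[kK notk] kmin] := ex_minnP notall.
rewrite (@big_cat_nat _ _ _ k) //=; last exact: ltnW.
have le0 : \sum_(0 <= l < k) rem (i, l) t <= 0.
  rewrite big_nat sumr_le0 // => l /andP[_ lk]; apply: completed_rem_le0.
  apply: contrapT => notl; suff : (k <= l)%N by rewrite leqNgt lk.
  by apply: kmin; apply/asboolP; split=> //; exact: ltn_trans kK.
have tail l : \sum_(l <= l' < K) rem (i, l') t <= (K - l)%:R * E i.
  rewrite mulr_natl -sumr_const_nat; apply: ler_sum_nat => l' _.
  exact: (rem_le_wcet (i, l')).
have kD : d (i, k) <= D by rewrite -njobsP.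
have KD : (K - k)%:R * p i <= D - r i k.
  by apply: njobs_period_le (ltnW kK) (le_trans (ltW (release_lt_deadline (i, k))) kD).
have [rt|rt] := leP (r i k) t; last first.
  have : U i * ((K - k)%:R * p i) <= U i * (D - t).
    by rewrite ler_wpM2l // (le_trans KD) // lerD2l lerN2 ltW.
  have := tail k; rewrite wcetRE; lra.
have [k' k'k ek'] := exists_enabled rt notk.
have kk' : k = k'.
  apply/eqP; rewrite eqn_leq k'k andbT; apply: kmin; apply/asboolP.
  by split; [exact: leq_ltn_trans kK|case: ek'].
rewrite -{k' k'k}kk' in ek'.
rewrite (activeI kD ek') mul1r (big_ltn kK); have := enabled_lag t0 tD ot ek'.
have : U i * ((K - k.+1)%:R * p i) <= U i * (D - d (i, k)).
  rewrite ler_wpM2l //; move: KD.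
  rewrite /deadline /= (_ : (K - k = (K - k.+1).+1)%N); last lia.
  by rewrite mulrSr mulrDl mul1r; lra.
by have := tail k.+1; rewrite wcetRE; lra.
Qed.

Definition rem_upto (D t : R) : R := \sum_(J <- jobs_upto D) rem J t.

Lemma rem_upto_growth D s t w : 0 <= s -> s <= t -> 0 <= w ->
  (forall t', s < t' < t -> w <= load sched (jobs_upto D) t') ->
  rem_upto D t <= rem_upto D s - w * (t - s).
Proof.
move=> s0 st w0 hw; have := work_growth_ge msched s0 st w0 hw.
rewrite /rem_upto /rem !sumrB; lra.
Qed.

Lemma rem_upto_few D t : 0 <= t -> t <= D -> (#|active D t| <= m.-1)%N ->
  (forall J, d J < D -> on_time J) ->
  rem_upto D t <= Rs * (D - t) + (Rs * x + pm).
Proof.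
move=> t0 tD few ot; rewrite /rem_upto sum_jobs_upto.
apply: (@le_trans _ _ (\sum_i (U i * (D - t) + (i \in active D t)%:R * (U i * x + b i)))).
  by apply: ler_sum => i _; exact: task_demand.
rewrite big_split /= -mulr_suml -raddf_sum; apply: lerD.
  by rewrite ler_wpM2r ?subr_ge0 // ler_rat.
have -> : \sum_i (i \in active D t)%:R * (U i * x + b i) =
    ratr (\sum_(i in active D t) (util tau i * x_bound P tau + excess tau i)) :> R.
  rewrite raddf_sum [RHS]big_mkcond; apply: eq_bigr => i _ /=.
  by case: ifP => _; [rewrite mul1r -rmorphM -rmorphD|rewrite mul0r].
by rewrite -rmorphM -rmorphD ler_rat (sum_lag_le hutil hPhi few).
Qed.

Lemma RsR_ge0 : 0 <= Rs. Proof. by rewrite ler0q (le_trans ler01) ?R_sum_ge1. Qed.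

Lemma pm_le i : pm <= p i. Proof. by rewrite ler_rat p_min_le. Qed.

Lemma pm_ge0 : 0 <= pm.
Proof.
(* Without tasks, [minl] takes its default value 0. *)
rewrite ler0q /p_min /minl; case: (enum 'I_n) => [|i s] /=; first by rewrite big_nil.
rewrite -[_ :: _]/(map (period tau) (i :: s)) big_map.
by apply: (big_ind (fun y : rat => 0 <= y)) => [|y z y0 z0|j _];
  rewrite ?le_min ?y0 // ltW ?period_gt0.
Qed.

Lemma rem_upto_0 D : 0 <= D -> rem_upto D 0 <= Rs * D.
Proof.
move=> D0; rewrite /rem_upto sum_jobs_upto.
apply: (@le_trans _ _ (\sum_i U i * D)); last first.
  by rewrite -mulr_suml -raddf_sum ler_wpM2r // ler_rat.
apply: ler_sum => i _; apply: (@le_trans _ _ ((njobs D i)%:R * E i)).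
  rewrite -[X in X%:R * _]subn0 mulr_natl -sumr_const_nat; apply: ler_sum_nat => k _.
  exact: (rem_le_wcet (i, k)).
rewrite wcetRE mulrCA ler_wpM2l ?utilR_ge0 //.
case: (posnP (njobs D i)) => [->|K0]; first by rewrite mul0r.
have iD : r i 0 <= D.
  by apply: le_trans (ltW (release_lt_deadline (i, 0%N))) _; rewrite -njobsP.
have := njobs_period_le (leq0n _) iD; rewrite subn0; have := release_ge0 i 0; lra.
Qed.

(** Here [f] is the urgent work beyond what a saturated platform can finish by [D]. After the last
    time with [f <= B], [rem_upto_few] rules out few active tasks, so the platform is saturated and
    [f] cannot grow. *)
Lemma rem_upto_deadline D : 0 <= D -> (forall J, d J < D -> on_time J) ->
  rem_upto D D <= Rs * x + pm.
Proof.
move=> D0 ot; have Rs0 := RsR_ge0; set B := Rs * x + pm.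
have B0 : 0 <= B by rewrite addr_ge0 ?pm_ge0 // mulr_ge0 // x_ge0R.
pose f t := rem_upto D t - Rs * (D - t).
have f0 : f 0 <= B.
  by have := rem_upto_0 D0; rewrite /f subr0; lra.
have lip y z : 0 <= y -> y <= z -> f z <= f y + Rs * (z - y).
  move=> y0 yz; suff : rem_upto D z <= rem_upto D y by rewrite /f; lra.
  by apply: ler_sum => J _; exact: rem_le.
have [a [a0 aD faB aB]] := last_below Rs0 D0 lip f0.
have : rem_upto D D <= rem_upto D a - Rs * (D - a); last by move: faB; rewrite /f; lra.
apply: rem_upto_growth => // t /andP[at_ tD].
have t0 : 0 <= t by rewrite (le_trans a0) ?ltW.
have [|few] := busy_or_few D t0; first exact: R_sum_le_load.
have := rem_upto_few t0 (ltW tD) few ot; have : B < f t by rewrite aB // at_ ltW.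
by rewrite /f /B; lra.
Qed.

(** * The induction on deadlines and the response-time bound *)

Lemma on_time_step J : (forall J', d J' < d J -> on_time J') -> on_time J.
Proof.
case: J => i k ot s /andP[s0 sp] /=; set D := d (i, k); set t' := D + x + s.
have D0 : 0 <= D := deadline_ge0 (i, k).
have x0 := x_ge0R; have v0 := rateR_gt0 i; have Rs0 := RsR_ge0.
have t'0 : 0 <= D + x by rewrite addr_ge0.
(* The deadline of the predecessor is at most [r i k], a period before [D], so it is complete by
   [D + x]. *)
have pred t : D + x <= t -> forall k', k = k'.+1 -> compl (i, k') t.
  move=> tD k' kk'; apply: (@on_time_completed _ _ _ _) => [l lk'|].
    apply: ot; apply: le_lt_trans (deadline_le i lk') _.
    have [_ rk'] := hr i k'; have := period_gt0R i; rewrite /D kk' /deadline /=; lra.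
  have [_ rk'] := hr i k'; move: tD; rewrite /D kk' /deadline /=; lra.
rewrite leNgt; apply/negP => late.
have not_compl t : 0 <= t -> t <= t' -> ~ compl (i, k) t.
  move=> t0 tt' kt; have := completed_rem_le0 (completed_le t0 tt' kt).
  have : 0 <= v i * (p i - s) by rewrite mulr_ge0 ?subr_ge0 // ltW.
  by move: late; lra.
have enabledk t : D + x <= t -> t <= t' -> enab t (i, k).
  move=> Dt tt'; split; [|by apply: not_compl; lra|by move=> k' /= kk'; exact: pred].
  by have := release_lt_deadline (i, k); rewrite -/D /=; lra.
have fast t : D + x < t < t' -> (#|active D t| <= m.-1)%N ->
    exists2 q, sched t q = Some (i, k) & v i <= ratr (speed q).
  move=> /andP[Dt tt'] few; have t0 : 0 <= t by lra.
  have [q tq] := few_active_runs t0 few (lexx D) (enabledk t (ltW Dt) (ltW tt')).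
  by exists q => //; exact: (rateR_le_speed t0 tq).
(* If the active tasks are few at some [t1], they stay few by [active_le], and job [k] runs
   throughout from [D + x] to [t']. *)
have [[t1 /andP[Dt1 t1x] few]|busy] :=
  pselect (exists2 t1, D <= t1 <= D + x & (#|active D t1| <= m.-1)%N).
  have Dt' : D + x <= t' by rewrite lerDl.
  have := @work_growth_ge _ _ _ _ msched [:: (i, k)] (v i) (D + x) t' t'0 Dt' (ltW v0).
  rewrite big_seq1 => grow.
  have : v i * (t' - (D + x)) <= W (i, k) t' - W (i, k) (D + x).
    apply: grow => t /andP[Dt tt'].
    have [||q tq vq] := fast t; first by rewrite Dt.
      by apply: leq_trans few; apply/subset_leq_card/active_le => //; lra.
    by apply: le_trans vq (speed_le_load _ tq); rewrite mem_seq1.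
  have := rem_le_wcet (i, k) t'0; have := wcetR_le_rate i.
  move: late; rewrite /rem /t' /=; lra.
(* Saturated from [D] to [D + x], the platform works off the part [Rs * x] of the backlog. *)
have h1 : rem_upto D (D + x) <= pm.
  have := @rem_upto_growth D D (D + x) Rs D0 _ Rs0.
  have := rem_upto_deadline D0 ot.
  move=> h /(_ _ _)/le_trans; apply; rewrite ?lerDl //; last lra.
  move=> t /andP[Dt tx]; have t0 : 0 <= t by lra.
  have [|few] := busy_or_few D t0; first exact: R_sum_le_load.
  by case: busy; exists t; rewrite ?(ltW Dt) ?(ltW tx).
(* Either every processor does urgent work, and [v i <= Rs], or job [k] itself runs at speed at
   least [v i]. *)
have h2 : rem_upto D t' <= rem_upto D (D + x) - v i * (t' - (D + x)).
  apply: rem_upto_growth; rewrite ?lerDl ?(ltW v0) // => t Dtt'.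
  have t0 : 0 <= t by case/andP: Dtt'; lra.
  have [allb|few] := busy_or_few D t0.
    exact: le_trans (rateR_le_R_sum i) (R_sum_le_load allb).
  have [q tq vq] := fast t Dtt' few.
  by apply: le_trans vq (speed_le_load _ tq); rewrite mem_jobs_upto.
have h3 : rem (i, k) t' <= rem_upto D t'.
  rewrite /rem_upto (perm_big _ (@perm_to_rem _ (i, k) _ _)) ?mem_jobs_upto // big_cons.
  by rewrite lerDl sumr_ge0 // => J _; apply: rem_ge0; rewrite /t'; lra.
(* As [v i >= 1], the remainder [pm - v i * s] is at most [v i * (p i - s)], against [late]. *)
have : p i <= v i * p i.
  by rewrite ler_peMl ?(ltW (period_gt0R _)) // -[1](rmorph1 (@ratr R)) ler_rat rate_ge1.
have := pm_le i; move: late h1 h2 h3; rewrite /t'; lra.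
Qed.

Lemma all_on_time J : on_time J.
Proof.
have [N] := ubnP (size (jobs_upto (d J))); elim: N J => // N IH J JN.
apply: on_time_step => J' J'J; apply: IH.
by rewrite -ltnS (leq_trans _ JN) // ltnS size_jobs_upto_lt.
Qed.

(** With [s] equal to the period, [on_time] gives completion by [d + x + p], which is
    [r + x + 2 * p]. *)
Lemma response_time_bound i :
  (response_time r c sched i <= (ratr (x_bound P tau + 2 * period tau i))%:E)%E.
Proof.
have x0 := x_ge0R; have p0 := period_gt0R i.
rewrite rmorphD rmorphM rmorph_nat; apply: ge_ereal_sup => _ [k _ <-].
rewrite /job_response_time ge_max lee_fin; apply/andP; split; first by lra.
rewrite leeBlDr // -EFinD.
apply: ereal_inf_lbound; exists (x + 2 * p i + r i k); last by [].
have := release_ge0 i k => rk; split; first by lra.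
apply: on_time_completed => [k' _|]; first exact: all_on_time.
by rewrite /deadline /=; lra.
Qed.

End Schedule.

Theorem theorem1 (R : realType) (P : platform) (n : nat) (tau : task_system n)
    (hutil : forall i : 'I_n, util tau i <= alpha_max P)
    (hPhi : forall k : 'I_(nkinds P).+1, (k < nkinds P)%N ->
       (#|Phi tau k| <= #|Psi k|)%N)
    (hU : U_sum tau <= R_sum P)
    (r c : 'I_n -> nat -> R)
    (hr : sporadic_releases tau r)
    (hc : bounded_workloads tau c)
    (sched : R -> assignment P n)
    (hS : gedfh_schedule tau r c sched)
    (i : 'I_n) :
  (response_time r c sched i <= (ratr (x_bound P tau + 2 * period tau i))%:E)%E.
Proof. exact: response_time_bound. Qed.
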